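(* Let $\mathsf{H}$ be a real Hilbert space with scalar product $\langle\cdot\mid\cdot\rangle$ and norm $\|\cdot\|$, let $A\colon\mathsf{H}\to 2^{\mathsf{H}}$ be a maximally monotone operator, and let $S\colon\mathsf{H}\to\mathsf{H}$ be a bounded linear operator such that $S^*=-S$. Let $x_0\in\mathsf{H}$, let $\varepsilon\in(0,1)$, let $\alpha\in(0,+\infty)$, let $\rho\in[\alpha,+\infty)$, and for every $n\in\mathbb{N}$, let $F_n\colon\mathsf{H}\to\mathsf{H}$ be $\alpha$-strongly monotone and $\rho$-Lipschitzian, and let $\lambda_n\in[\varepsilon,2-\varepsilon]$. Let $(u_n)_{n\in\mathbb{N}}$, $(e_n^* )_{n\in\mathbb{N}}$, and $(f_n^* )_{n\in\mathbb{N}}$ be arbitrary sequences in $\mathsf{H}$ (the terms $u_n,e_n^*,f_n^*$ may be chosen at iteration $n$), and let the sequences below be generated from $x_0$ by iterating, for $n=0,1,\ldots$, $$ \begin{aligned} u_n^*&=F_nu_n-Su_n+e_n^*+f_n^*,\\ y_n&=(F_n+A)^{-1}u_n^*,\\ a_n^*&=u_n^*-F_ny_n,\\ y_n^*&=a_n^*+Sy_n,\\ \pi_n&=\langle x_n\mid y_n^*\rangle-\langle y_n\mid a_n^*\rangle,\\ x_{n+1}&=\begin{cases}x_n-\dfrac{\lambda_n\pi_n}{\|y_n^*\|^2}\,y_n^*,&\text{if }\pi_n>0;\\[2mm] x_n,&\text{otherwise.}\end{cases} \end{aligned} $$ Suppose that $\operatorname{zer}(A+S)\neq\varnothing$. Then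 the following hold: (i) $\sum_{n\in\mathbb{N}}\|x_{n+1}-x_n\|^2<+\infty$. (ii) Suppose that $u_n-x_n\to 0$, that $e_n^*\to 0$, that $(f_n^* )_{n\in\mathbb{N}}$ is bounded, and that there exists $\delta\in(0,1)$ such that, for every $n\in\mathbb{N}$, $$ \begin{cases} \langle u_n-y_n\mid f_n^*\rangle\geq-\delta\,\langle u_n-y_n\mid F_nu_n-F_ny_n\rangle,\\ \langle a_n^*+Su_n-e_n^*\mid f_n^*\rangle\leq\delta\,\|a_n^*+Su_n-e_n^*\|^2. \end{cases} $$ Then $(x_n)_{n\in\mathbb{N}}$ converges weakly to a point in $\operatorname{zer}(A+S)$.
   Context: $2^{\mathsf{H}}$ is the power set of $\mathsf{H}$, so $A\colon\mathsf{H}\to 2^{\mathsf{H}}$ is a set-valued operator. $A$ is monotone if $\langle x-y\mid x^*-y^*\rangle\geq 0$ whenever $x^*\in Ax$ and $y^*\in Ay$; it is maximally monotone if, in addition, its graph is not properly contained in the graph of another monotone operator. For a set-valued operator $M\colon\mathsf{H}\to 2^{\mathsf{H}}$, $\operatorname{zer}M=\{x\in\mathsf{H}\mid 0\in Mx\}$, and $M^{-1}$ is the set-valued inverse: $x\in M^{-1}x^*$ if and only if $x^*\in Mx$. Here $F_n$ and $S$ are single-valued, $(A+S)x=\{a+Sx\mid a\in Ax\}$, $(F_n+A)x=\{F_nx+a\mid a\in Ax\}$, and $y_n=(F_n+A)^{-1}u_n^*$ means that $y_n$ is the unique point of $\mathsf{H}$ with $u_n^*\in F_ny_n+Ay_n$.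 A (possibly nonlinear) operator $F\colon\mathsf{H}\to\mathsf{H}$ is $\alpha$-strongly monotone if $\langle x-y\mid Fx-Fy\rangle\geq\alpha\|x-y\|^2$ for all $x,y\in\mathsf{H}$, and $\rho$-Lipschitzian if $\|Fx-Fy\|\leq\rho\|x-y\|$ for all $x,y\in\mathsf{H}$. $S^*$ denotes the adjoint of $S$. A superscript star on a vector (as in $u_n^*,e_n^*,f_n^*,a_n^*,y_n^*$) is only part of its name. The symbol $\to$ for sequences denotes strong (norm) convergence. $\mathbb{N}=\{0,1,2,\ldots\}$. *)

(* Defs.v *)
From HB Require Import structures.
From mathcomp Require Import all_boot all_order all_algebra.
From mathcomp Require Import all_classical all_reals all_analysis.
From mathcomp Require Import sesquilinear.

Set Implicit Arguments.
Unset Strict Implicit.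
Unset Printing Implicit Defensive.

Import Order.TTheory GRing.Theory Num.Theory.
Import numFieldNormedType.Exports.

Local Open Scope classical_set_scope.
Local Open Scope ring_scope.

(* A real Hilbert space is a [completeNormedModType R] together with a real
   scalar product [ip : {dot H for idfun}] (bilinear, symmetric, positive
   definite) that induces its norm. *)
Definition induces_norm (R : realType) (H : normedModType R)
    (ip : {dot H for idfun}) : Prop :=
  forall x : H, `|x| = Num.sqrt (ip x x).

Definition is_adjoint (R : realType) (H : normedModType R)
    (ip : {dot H for idfun}) (S T : H -> H) : Prop :=
  forall x y : H, ip (S x) y = ip x (T y).

(* Convergence for the weak topology, the coarsest one that makes every
   continuous linear functional continuous. *)
Definition weakly_cvg (R : realType) (H : normedModType R)
    (x : nat -> H) (l : H) : Prop :=
  forall phi : {scalar H}, continuous phi -> phi (x n) @[n --> \oo] --> phi l.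

(* A set-valued operator H -> 2^H is a function A : H -> set H; [A x v] reads
   "v belongs to A x". *)
Definition graph (H : Type) (A : H -> set H) : set (H * H) :=
  [set p | A p.1 p.2].

Definition set_inverse (H : Type) (A : H -> set H) : H -> set H :=
  fun v => [set x | A x v].

Definition zer (H : zmodType) (A : H -> set H) : set H := [set x | A x 0].

Definition monotone_op (R : realType) (H : normedModType R)
    (ip : {dot H for idfun}) (A : H -> set H) : Prop :=
  forall x y v w : H, A x v -> A y w -> 0 <= ip (x - y) (v - w).

Definition maximally_monotone (R : realType) (H : normedModType R)
    (ip : {dot H for idfun}) (A : H -> set H) : Prop :=
  monotone_op ip A /\
  forall B : H -> set H, monotone_op ip B -> ~ (graph A `<` graph B).

Definition strongly_monotone (R : realType) (H : normedModType R)
    (ip : {dot H for idfun}) (alpha : R) (F : H -> H) : Prop :=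
  forall x y : H, alpha * `|x - y| ^+ 2 <= ip (x - y) (F x - F y).

(* Main.v *)
Require Import Defs.
From HB Require Import structures.
From mathcomp Require Import all_boot all_order all_algebra.
From mathcomp Require Import all_classical all_reals all_analysis.
From mathcomp Require Import sesquilinear ring lra.
Set Implicit Arguments.
Unset Strict Implicit.
Unset Printing Implicit Defensive.
Import Order.TTheory GRing.Theory Num.Theory.
Import numFieldNormedType.Exports.
Local Open Scope classical_set_scope.
Local Open Scope ring_scope.

(** Write z for a zero of A + S, that is, -Sz is in Az. Skewness of S gives
    <v | Sv> = 0, so monotonicity of A applied to (z, -Sz) and (y_n, a_n)
    says that z lies in the half-space
      { v | <v | y*_n> <= <y_n | a_n> },     y*_n = a_n + S y_n,
    whereas pi_n > 0 means that x_n lies outside it. The iteration is thus a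
    relaxed projection onto a half-space containing all zeros, and such a
    step satisfies
      |x_(n+1) - z|^2 + (2/lambda_n - 1) |x_(n+1) - x_n|^2 <= |x_n - z|^2
    ([relaxed_projection_le]). As 2/lambda_n - 1 >= eps/2, telescoping
    ([decrease_summable]) gives summability of the squared steps, and
    convergence of |x_n - z| for every zero z.

    For the weak convergence, (y_n) is bounded because F_n is strongly
    monotone and Lipschitzian ([resolvent_dist]), hence so is (y*_n), and
    eps pi_n <= |x_(n+1) - x_n| |y*_n| bounds pi_n above by a null sequence.
    The first condition on f*_n makes pi_n at least
    (1 - delta) alpha |u_n - y_n|^2 up to null terms ([separation_gap]), so
    u_n - y_n -> 0. The second condition turns this into
    a_n + S u_n - e*_n -> 0 ([residual_le]), so y*_n -> 0. Consequently a
    weak cluster point of (x_n) is one of (y_n), with a_n in A y_n and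
    a_n + S y_n -> 0; passing to the limit in the monotonicity inequality,
    where <y_n | S y_n> vanishes by skewness, maximality of A makes it a zero
    of A + S ([weak_limit_zero]).

    It remains to see that a sequence whose distance to every point of a set Z
    converges, and whose weak cluster points are in Z, converges weakly to a
    point of Z ([opial]). Weak cluster points are obtained along
    ultrafilters: the scalar products <x_n | v> of a bounded sequence converge
    along any ultrafilter, their limit is a bounded linear form in v, and the
    Riesz representation theorem turns this form into a vector. Two cluster
    points z, z' in Z coincide because |x_n - z|^2 - |x_n - z'|^2, hence
    <x_n | z - z'>, converges. *)

(** * Sequences *)

Lemma bounded_fun_le (R : realType) (V : normedModType R) T (f : T -> V) :
  bounded_fun f -> exists M, forall t, `|f t| <= M.
Proof.
move=> [M [Mr hM]]; exists (M + 1) => t.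
by apply: (hM (M + 1)); rewrite ?ltrDl.
Qed.

Lemma sqr_cvg0 (R : realType) (V : normedModType R) T (G : set_system T)
    {FG : Filter G} (f : T -> V) :
  `|f t| ^+ 2 @[t --> G] --> (0 : R) -> f t @[t --> G] --> 0.
Proof.
move=> f0; apply/norm_cvg0P; rewrite -(sqrtr0 R).
under eq_fun do rewrite -[`|_|]ger0_norm // -sqrtr_sqr.
exact: cvg_comp f0 (@sqrt_continuous _ _).
Qed.

(** The terms c * d_n are dominated by the decrements of the nonincreasing
    nonnegative sequence b, whose total variation is at most b_0. *)
Lemma decrease_summable (R : realType) (b d : nat -> R) (c : R) : 0 < c ->
  (forall n, 0 <= b n) -> (forall n, 0 <= d n) ->
  (forall n, b n.+1 + c * d n <= b n) ->
  [/\ cvgn b, (\sum_(0 <= n <oo) (d n)%:E < +oo)%E & d n @[n --> \oo] --> 0].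
Proof.
move=> c0 b0 d0 bd.
have b_noninc : nonincreasing_seq b.
  apply/nonincreasing_seqP => n.
  by apply: le_trans (bd n); rewrite lerDl mulr_ge0 // ltW.
have b_cvg : cvgn b.
  by apply: nonincreasing_is_cvgn => //; exists 0 => _ [n _ <-].
have partial n : c * (\sum_(0 <= k < n) d k) <= b 0%N - b n.
  elim: n => [|n IH]; first by rewrite big_geq // mulr0 subrr.
  rewrite big_nat_recr //= mulrDr; have := bd n; lra.
split => //.
- apply: (@le_lt_trans _ _ (b 0%N / c)%:E); last exact: ltry.
  apply: lime_le; first by apply: is_cvg_nneseries => n _ _; rewrite lee_fin.
  apply: nearW => n; rewrite sumEFin lee_fin ler_pdivlMr // mulrC.
  by apply: le_trans (partial n) _; rewrite gerBl.
- have lim0 : c^-1 * (b n - b n.+1) @[n --> \oo] --> c^-1 * 0.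
    apply: cvgM; first exact: cvg_cst.
    rewrite -(subrr (limn b)); apply: cvgB => //.
    by have := b_cvg; rewrite -(cvg_shiftS b).
  rewrite mulr0 in lim0; apply: (squeeze_cvgr (f := fun=> 0) _ _ lim0).
    apply: nearW => n; rewrite d0 /= mulrC ler_pdivlMr // mulrC.
    have := bd n; lra.
  exact: cvg_cst.
Qed.

(** * Inner products *)

Section InnerProduct.
Context {R : realType} {H : completeNormedModType R} (ip : {dot H for idfun}).
Hypothesis ip_norm : induces_norm ip.

Lemma ipC x y : ip x y = ip y x.
Proof. by rewrite hermC expr0 mul1r. Qed.

Lemma ipDl x y z : ip (x + y) z = ip x z + ip y z.
Proof. exact: linearDl. Qed.

Lemma ipDr z x y : ip z (x + y) = ip z x + ip z y.
Proof. exact: linearDr. Qed.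

Lemma ipNl x z : ip (- x) z = - ip x z.
Proof. exact: linearNl. Qed.

Lemma ipNr z x : ip z (- x) = - ip z x.
Proof. exact: linearNr. Qed.

Lemma ip0l z : ip 0 z = 0.
Proof. exact: linear0l. Qed.

Lemma ip0r z : ip z 0 = 0.
Proof. exact: linear0r. Qed.

Lemma ipZl a x z : ip (a *: x) z = a * ip x z.
Proof. exact: linearZl_LR. Qed.

Lemma ipZr a z x : ip z (a *: x) = a * ip z x.
Proof. by rewrite ipC ipZl ipC. Qed.

Definition ipE := (ipDl, ipDr, ipNl, ipNr, ipZl, ipZr).

Lemma ip_ge0 x : 0 <= ip x x.
Proof.
have [->|x0] := eqVneq x 0; last exact/ltW/neq0_dnorm_gt0.
by rewrite ip0l.
Qed.

Lemma sqr_normE x : `|x| ^+ 2 = ip x x.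
Proof. by rewrite ip_norm sqr_sqrtr // ip_ge0. Qed.

Lemma cauchy_schwarz x y : `|ip x y| <= `|x| * `|y|.
Proof.
have [->|y0] := eqVneq y 0.
  by rewrite ip0r normr0 mulr_ge0.
have yy0 : 0 < ip y y by exact: neq0_dnorm_gt0.
rewrite -(@ler_sqr _ `|_|) ?nnegrE ?mulr_ge0 // real_normK ?num_real //.
rewrite exprMn !sqr_normE -(ler_pM2l yy0).
have := ip_ge0 (ip y y *: x - ip x y *: y).
rewrite !ipE (ipC y x).
rewrite [X in 0 <= X -> _](_ : _ =
  ip y y * (ip y y * ip x x - ip x y ^+ 2)); last by ring.
by rewrite (pmulr_rge0 _ yy0) subr_ge0 => h; rewrite ler_pM2l // mulrC.
Qed.

Lemma ip_le_norm x y : ip x y <= `|x| * `|y|.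
Proof. exact: le_trans (ler_norm _) (cauchy_schwarz x y). Qed.

Lemma cvg_ipl T (G : set_system T) {FG : Filter G} (f : T -> H) a v :
  f t @[t --> G] --> a -> ip (f t) v @[t --> G] --> ip a v.
Proof.
move=> fa; apply/cvgrPdist_lt => e e0.
have v1 : 0 < `|v| + 1 by rewrite ltr_wpDl.
move/cvgrPdist_lt/(_ _ (divr_gt0 e0 v1)) : fa.
apply: filterS => t /= ht; rewrite -ipNl -ipDl.
apply: le_lt_trans (cauchy_schwarz _ _) _.
rewrite (le_lt_trans (y := `|a - f t| * (`|v| + 1))) ?ler_wpM2l ?lerDl //.
by rewrite -ltr_pdivlMr.
Qed.

Lemma cvg_ip_bounded0 T (G : set_system T) {FG : Filter G} (f g : T -> H) M :
  (forall t, `|f t| <= M) -> g t @[t --> G] --> 0 ->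
  ip (f t) (g t) @[t --> G] --> 0.
Proof.
move=> fM g0; apply/norm_cvg0P.
have Mg0 : M * `|g t| @[t --> G] --> 0.
  by rewrite -(mulr0 M); apply: cvgM; [exact: cvg_cst | apply/norm_cvg0P].
apply: (squeeze_cvgr (f := fun=> 0) _ _ Mg0).
  apply: nearW => t; rewrite normr_ge0 /=.
  by apply: le_trans (cauchy_schwarz _ _) _; rewrite ler_wpM2r.
exact: cvg_cst.
Qed.

(** * Riesz representation and weak limits along ultrafilters *)

(** The representing vector minimizes J w = |w|^2 - 2 phi w. The parallelogram
    law makes a minimizing sequence w_n Cauchy. For its limit z, comparing
    J (w_n + t v) with the infimum of J and letting n go to infinity yields
    t^2 |v|^2 + 2 t (<z | v> - phi v) >= 0 for every t, which forces the
    linear coefficient to vanish. *)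
Lemma riesz_representation (phi : {scalar H}) (C : R) :
  (forall v, `|phi v| <= C * `|v|) -> exists z, forall v, phi v = ip z v.
Proof.
move=> phiC; pose J w := ip w w - 2 * phi w.
have phiD v w : phi (v + w) = phi v + phi w by exact: linearD.
have phiZ a w : phi (a *: w) = a * phi w by exact: linearZ.
(* From |phi w| <= C |w| and 0 <= (|w| - C)^2. *)
have JB w : - C ^+ 2 <= J w.
  have h : 2 * phi w <= 2 * (C * `|w|).
    by rewrite ler_pM2l // (le_trans (ler_norm _)).
  have := sqr_ge0 (`|w| - C); rewrite /J -sqr_normE sqrrB => h2; lra.
have JE : [set J w | w in setT] !=set0 by exists (J 0), 0.
have Jlb : has_lbound [set J w | w in setT].
  by exists (- C ^+ 2) => _ [w _ <-].
set m := inf [set J w | w in setT].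
have mJ w : m <= J w by apply: ge_inf => //; exists w.
have /choice [w wm] (n : nat) : exists w, J w < m + n.+1%:R^-1.
  have n0 : 0 < n.+1%:R^-1 :> R by rewrite invr_gt0.
  by have [_ [w _ <-]] := inf_adherent n0 (conj JE Jlb); exists w.
have wd p q : `|w p - w q| ^+ 2 <= 2 * (p.+1%:R^-1 + q.+1%:R^-1).
  (* The parallelogram law, with the midpoint bounded below by m. *)
  have := mJ (2^-1 *: (w p + w q)); have := wm p; have := wm q.
  rewrite sqr_normE /J phiZ phiD !ipE (ipC (w q) (w p)).
  move: (p.+1%:R^-1) (q.+1%:R^-1) => a b; lra.
have wc : cauchy (w @ \oo).
  apply: cauchy_exP => e e0.
  have e4 : 0 < e ^+ 2 / 4 by rewrite divr_gt0 ?exprn_gt0.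
  have [p _ hp] := near_infty_natSinv_lt (PosNum e4).
  exists (w p), p => // q /= pq; rewrite -ball_normE /=.
  rewrite -(@ltr_sqr _ `|_|) ?nnegrE ?normr_ge0 ?ltW //.
  apply: le_lt_trans (wd p q) _.
  have := hp p (leqnn p); have := hp q pq; rewrite /=.
  move: (p.+1%:R^-1) (q.+1%:R^-1) => a b; lra.
have [z wz] : exists z : H, w @ \oo --> z.
  by exists (limn w); apply/cauchy_cvgP.
exists z => v.
have key t : 0 <= t ^+ 2 * ip v v + 2 * t * (ip z v - phi v).
  have hc : n.+1%:R^-1 + (t ^+ 2 * ip v v + 2 * t * (ip (w n) v - phi v))
      @[n --> \oo] --> 0 + (t ^+ 2 * ip v v + 2 * t * (ip z v - phi v)).
    apply: cvgD; first exact: cvg_harmonic.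
    apply: cvgD; first exact: cvg_cst.
    apply: cvgM; first exact: cvg_cst.
    apply: cvgB; last exact: cvg_cst.
    exact: cvg_ipl.
  rewrite -[leRHS]add0r -(cvg_lim _ hc) //; apply: limr_ge; first exact: cvgP hc.
  apply: nearW => n; have := mJ (w n + t *: v); have := wm n.
  rewrite /J phiD phiZ !ipE (ipC v (w n)).
  move: (n.+1%:R^-1) => a; lra.
apply/eqP; rewrite eq_sym -subr_eq0; set d := ip z v - phi v in key *.
have v1 : 0 < ip v v + 1 by rewrite ltr_wpDl // ip_ge0.
(* The minimizing t would be - d / |v|^2; the shift by 1 covers v = 0. *)
have := key (- d / (ip v v + 1)).
rewrite [X in 0 <= X -> _](_ : _ =
   - (d ^+ 2 * (ip v v + 2) / (ip v v + 1) ^+ 2)); last by field; lra.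
rewrite oppr_ge0 pmulr_lle0 ?invr_gt0 ?exprn_gt0 // pmulr_lle0; last lra.
by move=> d0; rewrite -sqrf_eq0 eq_le d0 sqr_ge0.
Qed.

(** A bounded sequence clusters in a compact interval, and an ultrafilter
    converges to each of its cluster points. *)
Lemma ultra_bounded_cvg (U : set_system nat) (UU : UltraFilter U)
    (r : nat -> R) (M : R) : (forall n, `|r n| <= M) ->
  exists l : R, r n @[n --> U] --> l.
Proof.
move=> rM; have UP : ProperFilter U := @ultra_proper _ _ UU.
have rU : (r n @[n --> U]) `[- M, M]%classic.
  by apply: nearW => n /=; rewrite in_itv /= -ler_norml.
have [l [_ lcl]] := segment_compact _ rU.
exists l => B Bl; have [//|nUB] := in_ultra_setVsetC (r @^-1` B) UU.
by have [t [/=]] := lcl (~` B) _ nUB Bl.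
Qed.

(** Weak compactness of balls, in a form that extracts no subsequence: an ultrafilter selects a limit of <x_n | v> for all v at
    once, and these limits depend linearly on v. *)
Lemma bounded_weak_ultralimit (x : nat -> H) (M : R) (U : set_system nat)
    (UU : UltraFilter U) : (forall n, `|x n| <= M) ->
  exists z, forall v, ip (x n) v @[n --> U] --> ip z v.
Proof.
move=> xM; have UP : ProperFilter U := @ultra_proper _ _ UU.
have bnd v n : `|ip (x n) v| <= M * `|v|.
  by apply: le_trans (cauchy_schwarz _ _) _; rewrite ler_wpM2r.
have /choice [psi psiE] v := ultra_bounded_cvg UU (bnd v).
have psi_lin : linear_for *%R psi.
  move=> a v w; apply: (cvg_unique (@Rhausdorff R) (psiE (a *: v + w))).
  rewrite /=; under eq_fun do rewrite ipDr ipZr.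
  by apply: cvgD (psiE w); apply: cvgM (psiE v); exact: cvg_cst.
pose L := GRing.isLinear.Build R H R *%R psi psi_lin.
pose psiL : {scalar H} := HB.pack psi L.
have [v|z zE] := @riesz_representation psiL M.
  have hc : `|ip (x n) v| @[n --> U] --> `|psi v| by exact: cvg_norm (psiE v).
  rewrite -(cvg_lim _ hc) //; apply: limr_le; first exact: cvgP hc.
  by apply: nearW => n; exact: bnd.
by exists z => v; rewrite -(zE v); exact: psiE.
Qed.

Lemma bounded_sqr_dist (x : nat -> H) z :
  cvgn (fun n => `|x n - z| ^+ 2) -> exists M, forall n, `|x n| <= M.
Proof.
move=> /cvg_seq_bounded/bounded_fun_le[M hM].
exists (M + 1 + `|z|) => n.
rewrite -[x n](subrK z) (le_trans (ler_normD _ _)) // lerD2r.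
have := hM n; rewrite /= ger0_norm ?sqr_ge0 // => h.
have := sqr_ge0 (`|x n - z| - 1).
rewrite sqrrB; have := normr_ge0 (x n - z); nra.
Qed.

(** Opial's lemma. The candidate limit is the weak limit along one ultrafilter
    finer than the Frechet filter. If convergence failed for some functional
    phi, a set of indices not eventually avoided would keep phi x_n away from
    its expected limit; an ultrafilter concentrated on these indices would
    yield a different weak cluster point. *)
Lemma opial (x : nat -> H) (Z : set H) : Z !=set0 ->
  (forall z, Z z -> cvgn (fun n => `|x n - z| ^+ 2)) ->
  (forall (G : set_system nat) (z : H), ProperFilter G -> \oo `<=` G ->
    (forall v, ip (x n) v @[n --> G] --> ip z v) -> Z z) ->
  exists2 z, Z z & weakly_cvg x z.
Proof.
move=> [z0 Zz0] xZ clZ.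
have [M xM] := bounded_sqr_dist (xZ _ Zz0).
have clusters_eq (G1 G2 : set_system nat) z1 z2 :
    ProperFilter G1 -> ProperFilter G2 -> \oo `<=` G1 -> \oo `<=` G2 ->
    (forall v, ip (x n) v @[n --> G1] --> ip z1 v) ->
    (forall v, ip (x n) v @[n --> G2] --> ip z2 v) -> z1 = z2.
  move=> P1 P2 G1oo G2oo xz1 xz2.
  have Zz1 : Z z1 by exact: clZ xz1.
  have Zz2 : Z z2 by exact: clZ xz2.
  (* |x_n - z2|^2 - |x_n - z1|^2 is affine in <x_n | z1 - z2>. *)
  have [l xl] : exists l : R, ip (x n) (z1 - z2) @[n --> \oo] --> l.
    have hc := cvgB (xZ _ Zz2) (xZ _ Zz1).
    have E n : ip (x n) (z1 - z2) = 2^-1 *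
        (`|x n - z2| ^+ 2 - `|x n - z1| ^+ 2 - (ip z2 z2 - ip z1 z1)).
      by rewrite !sqr_normE !ipE (ipC z1) (ipC z2); field.
    exists (2^-1 * (limn (fun n => `|x n - z2| ^+ 2) -
      limn (fun n => `|x n - z1| ^+ 2) - (ip z2 z2 - ip z1 z1))).
    under eq_fun do rewrite E.
    apply: cvgM; first exact: cvg_cst.
    by apply: cvgB; [exact: hc | exact: cvg_cst].
  have l1 : ip z1 (z1 - z2) = l.
    apply: (cvg_unique (@Rhausdorff R) (xz1 _)).
    by apply: cvg_trans xl; exact: cvg_app.
  have l2 : ip z2 (z1 - z2) = l.
    apply: (cvg_unique (@Rhausdorff R) (xz2 _)).
    by apply: cvg_trans xl; exact: cvg_app.
  apply/eqP; rewrite -subr_eq0 -normr_eq0 -sqrf_eq0 sqr_normE.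
  by rewrite ipDl ipNl l1 l2 subrr.
have [U [UU Uoo]] := @ultraFilterLemma _ (\oo) _.
have UP := @ultra_proper _ _ UU.
have [z xz] := bounded_weak_ultralimit UU xM.
exists z; first exact: clZ xz.
move=> phi phi_cont.
have [r rE] : exists r, forall v, phi v = ip r v.
  have /linear_bounded_continuous/linear_boundedP := phi_cont.
  move=> [C [Cr hC]]; apply: (@riesz_representation phi (C + 1)) => v.
  by apply: hC; rewrite ltrDl.
move=> B; rewrite rE => Bz; apply: contrapT => nB.
have Pw : ProperFilter (within (~` ((phi \o x) @^-1` B)) \oo).
  split => [w0|]; last exact: within_filter.
  apply: nB; move: w0; rewrite /within /= => w0.
  by near=> n; apply: contrapT; near: n.
have [V [VU Voo]] := ultraFilterLemma Pw.
have VP := @ultra_proper _ _ VU.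
have V_oo : \oo `<=` V by apply: subset_trans Voo; exact: cvg_within.
have [z' xz'] := bounded_weak_ultralimit VU xM.
have zz' := clusters_eq _ _ _ _ UP VP Uoo V_oo xz xz'.
have VB : V ((phi \o x) @^-1` B).
  have -> : phi \o x = fun n => ip (x n) r by apply/funext => n /=; rewrite rE ipC.
  by apply: (xz' r); rewrite -zz' ipC.
have VnB : V (~` ((phi \o x) @^-1` B)) by apply: Voo; exact: withinT.
by have [n []] := filter_ex (filterI VB VnB).
Unshelve. all: by end_near.
Qed.

(** * Monotone operators and skew perturbations *)

(** Otherwise adjoining (z, b) to the graph of A would be a proper monotone
    extension. *)
Lemma maximally_monotone_mem (A : H -> set H) z b :
  maximally_monotone ip A ->
  (forall v w, A v w -> 0 <= ip (z - v) (b - w)) -> A z b.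
Proof.
move=> [Am Amax] zb; apply: contrapT => nAzb.
pose B v := [set w | A v w \/ (v = z /\ w = b)].
have Bm : monotone_op ip B.
  move=> x y v w [xv|[-> ->]] [yw|[-> ->]].
  - exact: Am.
  - by rewrite -(opprB z) -(opprB b) ipNl ipNr opprK; exact: zb.
  - exact: zb.
  - by rewrite subrr ip0l.
apply: (Amax B Bm); split => [p Ap|BA]; first by left.
by apply: nAzb; apply: (BA (z, b)); right.
Qed.

Section SkewSum.
Variables (A : H -> set H) (S : {linear H -> H}).
Hypothesis S_skew : is_adjoint ip S (fun x => - S x).

Lemma skewC x y : ip x (S y) = - ip (S x) y.
Proof. by rewrite S_skew ipNr opprK. Qed.

Lemma skew_diag x : ip x (S x) = 0.
Proof. by have := skewC x x; rewrite (ipC (S x)); lra. Qed.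

Lemma zer_addP z : zer (fun z => [set a + S z | a in A z]) z <-> A z (- S z).
Proof.
split=> [[a Aza /eqP]|AzS]; last by exists (- S z); rewrite ?addNr.
by rewrite addr_eq0 => /eqP <-.
Qed.

(** The graph of A + S is closed for weak convergence of points and strong
    convergence of values. Skewness removes the only product of two weakly
    convergent terms, <p_t | S p_t>, from <p_t - v | a_t - w>; all remaining
    terms pass to the limit. *)
Lemma weak_limit_zero T (G : set_system T) {PG : ProperFilter G}
    (p a : T -> H) (M : R) z :
  maximally_monotone ip A -> (forall t, A (p t) (a t)) ->
  (forall t, `|p t| <= M) -> (forall v, ip (p t) v @[t --> G] --> ip z v) ->
  a t + S (p t) @[t --> G] --> 0 -> A z (- S z).
Proof.
move=> Amax Apa pM pz aS0; apply: maximally_monotone_mem => // v w Avw.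
have pvM t : `|p t - v| <= M + `|v|.
  by rewrite (le_trans (ler_normB _ _)) // lerD2r.
have E t : ip (p t - v) (a t - w) = ip (p t - v) (a t + S (p t))
    - ip (p t) (S v) - ip (p t) w + ip v w.
  rewrite !ipE skew_diag (skewC v) (ipC (S v)); ring.
have lim : ip (p t - v) (a t - w) @[t --> G] -->
    0 - ip z (S v) - ip z w + ip v w.
  under eq_fun do rewrite E.
  apply: cvgD; last exact: cvg_cst.
  apply: cvgB (pz _); apply: cvgB (pz _).
  exact: cvg_ip_bounded0 pvM aS0.
rewrite (_ : ip _ _ = 0 - ip z (S v) - ip z w + ip v w).
  rewrite -(cvg_lim _ lim) //; apply: limr_ge; first exact: cvgP lim.
  by apply: nearW => t; apply: Amax.1.
rewrite !ipE skew_diag (skewC v) (ipC (S v)); ring.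
Qed.

(** Monotonicity of A at (p, a) and (z, -Sz), with the quadratic terms in S
    removed by skewness: the zeros of A + S lie in a half-space with normal
    a + S p. *)
Lemma zero_separation z p a : monotone_op ip A -> A z (- S z) -> A p a ->
  ip z (a + S p) <= ip p a.
Proof.
move=> Am Az Apa; have := Am _ _ _ _ Apa Az.
rewrite !ipE skew_diag (skewC z p) (ipC (S z)); lra.
Qed.

(** Strong monotonicity of F at p and z, added to monotonicity of A at p and z
    (with -Sz as the value at z), gives alpha |p - z|^2 <= <p - z | F u - F z - S (u - z) + e + f>. *)
Lemma resolvent_dist (F : H -> H) (alpha rho L : R) z p u e f :
  monotone_op ip A -> A z (- S z) ->
  strongly_monotone ip alpha F -> (forall v w, `|F v - F w| <= rho * `|v - w|) ->
  (forall v, `|S v| <= L * `|v|) -> A p (F u - S u + e + f - F p) ->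
  alpha * `|p - z| <= (rho + L) * `|u - z| + `|e| + `|f|.
Proof.
move=> Am Az F_mono F_lip SL Ap.
have [->|pz] := eqVneq p z.
  rewrite subrr normr0 mulr0 !addr_ge0 // mulrDl addr_ge0 //.
    exact: le_trans (F_lip u z).
  exact: le_trans (SL (u - z)).
rewrite -(ler_pM2r (x := `|p - z|)) ?normr_gt0 ?subr_eq0 //.
rewrite -mulrA -expr2; apply: le_trans (F_mono p z) _.
have := Am _ _ _ _ Ap Az.
set r := (X in 0 <= ip _ X -> _) => r0.
have : ip (p - z) (F p - F z + r) <=
    ((rho + L) * `|u - z| + `|e| + `|f|) * `|p - z|.
  apply: le_trans (ip_le_norm _ _) _; rewrite mulrC ler_wpM2r //.
  rewrite (_ : F p - F z + r = (F u - F z) - S (u - z) + e + f); last first.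
    rewrite /r opprK linearB opprB (addrC (F p)) -(addrA _ (F p)).
    rewrite (addrA (F p)) (addrC (F p)) subrK !addrA.
    by rewrite [LHS](ACl (2*1*6*3*4*5)).
  apply: le_trans (ler_normD _ _) _; rewrite lerD2r.
  apply: le_trans (ler_normD _ _) _; rewrite lerD2r.
  apply: le_trans (ler_normB _ _) _; rewrite mulrDl lerD //.
by rewrite ipDr; lra.
Qed.

(** With v = a + S p, one has <x | v> - <p | a> = <x - u | v> + <u - p | v>, and
    in <u - p | v> the term with S vanishes, the one with F is at least
    alpha |u - p|^2, and the one with f costs at most the fraction delta of the
    latter. *)
Lemma separation_gap (F : H -> H) (alpha delta : R) x u p a e f :
  a = F u - S u + e + f - F p -> delta < 1 -> strongly_monotone ip alpha F ->
  - delta * ip (u - p) (F u - F p) <= ip (u - p) f ->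
  (1 - delta) * alpha * `|u - p| ^+ 2 <=
    ip x (a + S p) - ip p a + `|u - p| * `|e| + `|x - u| * `|a + S p|.
Proof.
move=> aE d1 F_mono hf.
have E : ip x (a + S p) - ip p a = ip (x - u) (a + S p) +
    (ip (u - p) (F u - F p) + ip (u - p) e + ip (u - p) f).
  rewrite aE !ipE !skew_diag !(skewC p) (ipC (S p)); ring.
have := cauchy_schwarz (x - u) (a + S p); have := cauchy_schwarz (u - p) e.
rewrite !ler_norml => /andP[he _] /andP[hx _].
have hF : (1 - delta) * (alpha * `|u - p| ^+ 2) <=
    (1 - delta) * ip (u - p) (F u - F p).
  by rewrite ler_pM2l ?subr_gt0.
by rewrite E; lra.
Qed.

End SkewSum.

(** Split |d + f|^2 into <d + f | d> + <d + f | f>; the second product is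
    absorbed by the hypothesis. *)
Lemma residual_le (delta : R) d f : ip (d + f) f <= delta * `|d + f| ^+ 2 ->
  (1 - delta) * `|d + f| <= `|d|.
Proof.
move=> hf; have [->|w0] := eqVneq (d + f) 0; first by rewrite normr0 mulr0.
rewrite -(ler_pM2r (x := `|d + f|)) ?normr_gt0 // -mulrA -expr2 (mulrC `|d|).
apply: le_trans (ip_le_norm _ _).
have : `|d + f| ^+ 2 = ip (d + f) d + ip (d + f) f by rewrite sqr_normE ipDr.
lra.
Qed.

(** Here x' is a relaxed projection of x onto a half-space with normal v that
    contains z, and p is the amount by which x violates its inequality. In the
    expansion of |x' - z|^2 the cross term - 2 t <x - z | v> is at most
    - 2 t p, where t |v|^2 = lam p. The final equality bounds the violation by
    the length of the step. *)
Lemma relaxed_projection_le x z v (lam p : R) : 0 < lam -> 0 < p ->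
  p <= ip (x - z) v -> let x' := x - (lam * p / `|v| ^+ 2) *: v in
  `|x' - z| ^+ 2 + (2 / lam - 1) * `|x' - x| ^+ 2 <= `|x - z| ^+ 2 /\
  lam * p = `|x' - x| * `|v|.
Proof.
move=> lam0 p0 pv x'.
have v0 : v != 0 by apply: contraTneq pv => ->; rewrite ip0r -ltNge.
have nv0 : 0 < `|v| by rewrite normr_gt0.
set t := lam * p / `|v| ^+ 2 in x' *.
have t0 : 0 < t by rewrite divr_gt0 ?mulr_gt0 ?exprn_gt0.
have tE : t * `|v| ^+ 2 = lam * p by rewrite /t divfK // sqrf_eq0 gt_eqF.
have dE : x' - x = - (t *: v) by rewrite /x' addrAC subrr add0r.
split; last by rewrite dE normrN normrZ gtr0_norm // -mulrA -expr2 tE.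
have -> : `|x' - x| ^+ 2 = t * (lam * p).
  by rewrite dE normrN normrZ gtr0_norm // exprMn -tE; ring.
have -> : `|x' - z| ^+ 2 = `|x - z| ^+ 2 - 2 * t * ip (x - z) v + t * (lam * p).
  rewrite -tE !sqr_normE /x' addrAC; move: (x - z) => q.
  by rewrite !ipE (ipC v q); ring.
have -> : (2 / lam - 1) * (t * (lam * p)) = 2 * t * p - t * (lam * p).
  by field; rewrite gt_eqF.
have : 2 * t * p <= 2 * t * ip (x - z) v by rewrite ler_pM2l // mulr_gt0.
by lra.
Qed.

End InnerProduct.

(** * Convergence of the algorithm *)

Theorem theorem3
  (R : realType) (H : completeNormedModType R)
  (ip : {dot H for idfun}) (ip_norm : induces_norm ip)
  (A : H -> set H) (A_max : maximally_monotone ip A)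
  (S : {linear H -> H}) (S_bounded : bounded_near S (nbhs (0 : H)))
  (S_skew : is_adjoint ip S (fun x => - S x))
  (x0 : H)
  (eps : R) (eps_range : 0 < eps < 1)
  (alpha : R) (alpha_gt0 : 0 < alpha)
  (rho : R) (rho_ge : alpha <= rho)
  (F : nat -> H -> H)
  (F_mono : forall n : nat, strongly_monotone ip alpha (F n))
  (F_lip : forall n : nat, rho.-lipschitz (F n))
  (lambda : nat -> R)
  (lambda_range : forall n : nat, eps <= lambda n <= 2 - eps)
  (u e_s f_s : nat -> H)
  (u_s y a_s y_s : nat -> H) (pi_ : nat -> R) (x : nat -> H)
  (u_sE : forall n : nat, u_s n = F n (u n) - S (u n) + e_s n + f_s n)
  (yE : forall n : nat,
     set_inverse (fun z => [set F n z + a | a in A z]) (u_s n) = [set y n])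
  (a_sE : forall n : nat, a_s n = u_s n - F n (y n))
  (y_sE : forall n : nat, y_s n = a_s n + S (y n))
  (pi_E : forall n : nat, pi_ n = ip (x n) (y_s n) - ip (y n) (a_s n))
  (x0E : x 0%N = x0)
  (xSE : forall n : nat, x n.+1 =
     if 0 < pi_ n then x n - (lambda n * pi_ n / `|y_s n| ^+ 2) *: y_s n
     else x n)
  (zer_neq0 : zer (fun z => [set a + S z | a in A z]) !=set0) :
  (\sum_(0 <= n <oo) (`|x n.+1 - x n| ^+ 2)%:E < +oo)%E
  /\
  ((u n - x n) @[n --> \oo] --> (0 : H) ->
   e_s n @[n --> \oo] --> (0 : H) ->
   bounded_fun f_s ->
   (exists delta : R, 0 < delta < 1 /\
      forall n : nat,
        - delta * ip (u n - y n) (F n (u n) - F n (y n))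
          <= ip (u n - y n) (f_s n)
        /\
        ip (a_s n + S (u n) - e_s n) (f_s n)
          <= delta * `|a_s n + S (u n) - e_s n| ^+ 2) ->
   exists2 z : H, zer (fun z => [set a + S z | a in A z]) z & weakly_cvg x z).
Proof.
move: eps_range => /andP[eps0 eps1].
have [L L0 SL] : exists2 L, 0 <= L & forall v, `|S v| <= L * `|v|.
  have /linear_boundedP[M [Mr hM]] := S_bounded.
  exists `|M + 1| => // v; apply: le_trans (hM (M + 1) _ v) _.
    by rewrite ltrDl.
  by rewrite ler_wpM2r // ler_norm.
have Aya n : A (y n) (a_s n).
  have : set_inverse (fun z => [set F n z + a | a in A z]) (u_s n) (y n).
    by rewrite yE.
  by move=> [a Aa aE]; rewrite a_sE -aE addrAC subrr add0r.
have pi_le z n : A z (- S z) -> pi_ n <= ip (x n - z) (y_s n).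
  move=> Az; rewrite pi_E ipDl ipNl lerD2l lerN2 y_sE.
  exact: (zero_separation S_skew A_max.1 Az).
have step z n : A z (- S z) ->
    `|x n.+1 - z| ^+ 2 + eps / 2 * `|x n.+1 - x n| ^+ 2 <= `|x n - z| ^+ 2 /\
    eps * pi_ n <= `|x n.+1 - x n| * `|y_s n|.
  move=> Az; rewrite xSE; case: ifPn => [pi0|]; last first.
    rewrite -leNgt => pi0; rewrite subrr normr0 expr0n /= mulr0 addr0 mul0r.
    by rewrite pmulr_rle0.
  have /andP[lam_ge lam_le] := lambda_range n.
  have lam0 : 0 < lambda n by exact: lt_le_trans lam_ge.
  have [dist_le <-] := relaxed_projection_le ip_norm lam0 pi0 (pi_le z n Az).
  split; last by rewrite ler_wpM2r // ltW.
  apply: le_trans dist_le; rewrite lerD2l ler_wpM2r ?sqr_ge0 //.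
  (* 2 / lambda_n - 1 >= 2 / (2 - eps) - 1 = eps / (2 - eps) >= eps / 2 *)
  rewrite lerBrDr ler_pdivlMr //; nra.
have dist_cvg z : A z (- S z) -> [/\ cvgn (fun n => `|x n - z| ^+ 2),
    (\sum_(0 <= n <oo) (`|x n.+1 - x n| ^+ 2)%:E < +oo)%E &
    `|x n.+1 - x n| ^+ 2 @[n --> \oo] --> 0].
  move=> Az; apply: (@decrease_summable _ (fun n => `|x n - z| ^+ 2)
    (fun n => `|x n.+1 - x n| ^+ 2) (eps / 2)) => [|n|n|n]; rewrite ?sqr_ge0 //.
    by rewrite divr_gt0.
  exact: (step z n Az).1.
have [z0 /zer_addP Az0] := zer_neq0.
have [z0_cvg x_sum dx_cvg] := dist_cvg z0 Az0.
split => // ux0 e0 f_bnd [delta [/andP[delta0 delta1] f_cond]].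
have rho0 : 0 < rho by exact: lt_le_trans rho_ge.
have F_le n v w : `|F n v - F n w| <= rho * `|v - w|.
  exact: (F_lip n (v, w) (conj I I)).
have [Mx xM] := bounded_sqr_dist z0_cvg.
have [Mux uxM] := bounded_fun_le (cvg_seq_bounded (cvgP _ ux0)).
have [Me eM] := bounded_fun_le (cvg_seq_bounded (cvgP _ e0)).
have [Mf fM] := bounded_fun_le f_bnd.
have rL0 : 0 <= rho + L by rewrite addr_ge0 // ltW.
have [Mz yzM] : exists M, forall n, `|y n - z0| <= M.
  exists (((rho + L) * (Mux + (Mx + `|z0|)) + Me + Mf) / alpha) => n.
  rewrite ler_pdivlMr // mulrC.
  apply: (le_trans (resolvent_dist (u := u n) (e := e_s n) (f := f_s n)
    ip_norm A_max.1 Az0 (F_mono n) (F_le n) SL _)).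
    by rewrite -u_sE -a_sE.
  rewrite !lerD // ler_wpM2l // -[u n](subrK (x n)) -addrA.
  rewrite (le_trans (ler_normD _ _)) // lerD //.
  by rewrite (le_trans (ler_normB _ _)) // lerD.
have yM n : `|y n| <= Mz + `|z0|.
  by rewrite -[y n](subrK z0) (le_trans (ler_normD _ _)) // lerD.
have [Muy uyM] : exists M, forall n, `|u n - y n| <= M.
  exists (Mux + Mx + (Mz + `|z0|)) => n.
  rewrite (le_trans (ler_normB _ _)) // lerD //.
  by rewrite -[u n](subrK (x n)) (le_trans (ler_normD _ _)) // lerD.
have aE n : a_s n = F n (u n) - S (u n) + e_s n + f_s n - F n (y n).
  by rewrite a_sE u_sE.
(* The second condition on f_s concerns this vector, which is f_s up to the
   vanishing term F_n u_n - F_n y_n. *)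
have wE n : a_s n + S (u n) - e_s n = F n (u n) - F n (y n) + f_s n.
  rewrite aE; move: (F n (u n)) (S (u n)) (e_s n) (f_s n) (F n (y n)).
  move=> Fu Su e f Fy; rewrite [LHS](ACl ((1*5*4)*(2*6)*(3*7))%AC) /=.
  by rewrite addNr subrr !addr0.
have ysE n : y_s n = a_s n + S (u n) - e_s n + e_s n - S (u n - y n).
  by rewrite y_sE linearB opprB subrK addrCA addrK addrC.
have [My ysM] : exists M, forall n, `|y_s n| <= M.
  exists (rho * Muy + Mf + Me + L * Muy) => n.
  rewrite ysE wE (le_trans (ler_normB _ _)) // lerD //; last first.
    by apply: le_trans (SL _) _; rewrite ler_wpM2l.
  rewrite (le_trans (ler_normD _ _)) // lerD //.
  rewrite (le_trans (ler_normD _ _)) // lerD //.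
  by apply: le_trans (F_le _ _ _) _; rewrite ler_wpM2l // ltW.
have dx0 : `|x n.+1 - x n| @[n --> \oo] --> 0.
  by apply/norm_cvg0P; exact: sqr_cvg0.
have ne0 : `|e_s n| @[n --> \oo] --> 0 by apply/norm_cvg0P.
have nux0 : `|u n - x n| @[n --> \oo] --> 0 by apply/norm_cvg0P.
have cst0 (c : R) (r : nat -> R) : r n @[n --> \oo] --> 0 ->
    c * r n @[n --> \oo] --> 0.
  by move=> r0; rewrite -(mulr0 c); apply: cvgM r0; exact: cvg_cst.
have sum0 (r s : nat -> R) : r n @[n --> \oo] --> 0 -> s n @[n --> \oo] --> 0 ->
    r n + s n @[n --> \oo] --> 0.
  by move=> r0 s0; rewrite -(addr0 0); exact: cvgD.
have squeeze0 (r s : nat -> R) : (forall n, 0 <= r n <= s n) ->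
    s n @[n --> \oo] --> 0 -> r n @[n --> \oo] --> 0.
  move=> rs s0; apply: (squeeze_cvgr (f := fun=> 0) _ _ s0); last exact: cvg_cst.
  exact: nearW.
have cda0 : 0 < (1 - delta) * alpha by rewrite mulr_gt0 ?subr_gt0.
have uy0 : u n - y n @[n --> \oo] --> 0.
  apply: sqr_cvg0.
  apply: (squeeze0 _ (fun n => ((1 - delta) * alpha)^-1 *
    (My / eps * `|x n.+1 - x n| + Muy * `|e_s n| + My * `|u n - x n|))).
    move=> n; rewrite sqr_ge0 /= mulrC ler_pdivlMr // mulrC.
    have [hf _] := f_cond n.
    apply: (le_trans (separation_gap ip_norm S_skew (x n) (aE n) delta1
      (F_mono n) hf)).
    rewrite -y_sE -pi_E lerD //; last first.
      by rewrite (distrC (x n)) mulrC ler_wpM2r.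
    rewrite lerD //; last by rewrite ler_wpM2r.
    rewrite mulrAC ler_pdivlMr // mulrC.
    apply: le_trans (step z0 n Az0).2 _.
    by rewrite mulrC ler_wpM2r.
  by apply: (cst0); apply: (sum0); [apply: (sum0)|]; apply: (cst0).
have nuy0 : `|u n - y n| @[n --> \oo] --> 0 by apply/norm_cvg0P.
have ys0 : a_s n + S (y n) @[n --> \oo] --> 0.
  apply/norm_cvg0P.
  apply: (squeeze0 _ (fun n => rho / (1 - delta) * `|u n - y n| + `|e_s n| +
    L * `|u n - y n|)) => [n|]; last first.
    by apply: (sum0); [apply: (sum0) => //|]; apply: (cst0).
  rewrite normr_ge0 /= -y_sE ysE (le_trans (ler_normB _ _)) // lerD //.
  rewrite (le_trans (ler_normD _ _)) // lerD //.
  rewrite mulrAC ler_pdivlMr ?subr_gt0 // mulrC.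
  have [_ hf] := f_cond n; rewrite wE in hf *.
  exact: le_trans (residual_le ip_norm hf) (F_le _ _ _).
apply: (opial ip_norm) => //.
- by move=> z /zer_addP Az; have [] := dist_cvg z Az.
- move=> G z PG Goo xz; apply/zer_addP.
  apply: (weak_limit_zero (G := G) ip_norm S_skew A_max Aya yM); last first.
    by apply: cvg_trans ys0; exact: cvg_app.
  move=> v.
  (* y_n and x_n have the same weak limits, both being close to u_n. *)
  have yx0 : ip (u n - x n) v - ip (u n - y n) v @[n --> G] --> 0.
    rewrite -(subr0 0) -[in X in _ --> X - _](ip0l ip v) -(ip0l ip v).
    by apply: cvgB; apply: cvg_ipl => //;
      [apply: cvg_trans ux0 | apply: cvg_trans uy0]; exact: cvg_app.
  have E n : ip (y n) v = ip (x n) v + (ip (u n - x n) v - ip (u n - y n) v).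
    by rewrite !ipE; ring.
  under eq_fun do rewrite E.
  by rewrite -[ip z v]addr0; exact: cvgD.
Qed.
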